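(* Let $S$ be a (connected) oriented closed surface with a cellular decomposition $\mathcal{D}$ and a weight $\Phi:E\to(0,\pi)$ such that $\sum_{l=1}^{m}\Phi(e_l)=(m-2)\pi$ whenever $e_1,\dots,e_m$ are the edges forming the boundary of a 2-cell of $\mathcal{D}$. In the Euclidean background geometry, the image $\mathbf{K}(\mathbb{R}^N_{>0})$ of the curvature map satisfies $$\Big\{x\in\mathbb{R}^N:\sum_{i\in V}x_i=2\pi\chi(S)\Big\}\cap\prod_{i\in V}\Big[2\pi-\mathcal{L}(\mathcal{D},\Phi)_i,\;2\pi\Big)\subset\mathbf{K}\big(\mathbb{R}^N_{>0}\big)$$ and $$\prod_{i\in V}\Big(-\infty,\;2\pi-\mathcal{L}(\mathcal{D},\Phi)_i\Big)\cap\mathbf{K}\big(\mathbb{R}^N_{>0}\big)=\emptyset.$$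
   Context: $V=\{v_1,\dots,v_N\}$, $E$, $F$ are the vertices, edges and 2-cells of $\mathcal{D}$; $\Phi_{ij}$ is the value of $\Phi$ on the edge $e_{ij}$ joining $v_i,v_j$; $\chi(S)$ is the Euler characteristic. Sums $\sum_{j\sim i}$ run over the neighbours of $i$, i.e. over the edges at $i$ (one term for each edge-end at $v_i$); the edges bounding a 2-cell are listed as met when traversing its boundary once. The character at $i$ is $\mathcal{L}(\mathcal{D},\Phi)_i=\sum_{j\sim i}\Phi_{ij}$. For a radius vector $r=(r_1,\dots,r_N)\in\mathbb{R}^N_{>0}$ and an edge $e_{ij}$, consider in the Euclidean plane the triangle whose vertices are the centers $i,j$ of two circles of radii $r_i,r_j$ meeting with exterior intersection angle $\Phi_{ij}$ and one of the intersection points of the two circles. Its sides have lengths $r_i$ (from $i$ to the intersection point), $r_j$ (from $j$ to the intersection point) and $l_{ij}=\sqrt{r_i^2+r_j^2+2r_ir_j\cos\Phi_{ij}}$. Let $\theta_i^j=\theta_i^j(r_i,r_j)\in(0,\pi)$ be its inner angle at the center $i$. The vertex curvature is $K_i(r)=2\pi-2\sum_{j\sim i}\theta_i^j$, and the curvature map is $\mathbf{K}:\mathbb{R}^N_{>0}\to\mathbb{R}^N$, $r\mapsto(K_1(r),\dots,K_N(r))$. *)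

(* Defs.v *)
From mathcomp Require Import all_boot all_order all_algebra all_fingroup.
From mathcomp Require Import all_classical all_reals all_analysis.
Set Implicit Arguments.
Unset Strict Implicit.
Unset Printing Implicit Defensive.
Import Order.TTheory GRing.Theory Num.Theory.
Local Open Scope ring_scope.

(* A cellular decomposition of a connected oriented closed surface, encoded as
   a combinatorial map.  Darts are the oriented edges (equivalently, edge-ends:
   a dart is attached to its origin).  [flip] reverses a dart, without fixed
   point since the two ends of an edge are distinct darts.  [turn] sends a dart
   to the next one around the same origin, for the cyclic order given by the
   orientation.  The cycles of [turn], [flip] and of their product are the
   vertices, the edges and the 2-cells; every edge has a 2-cell on each side,
   so that the surface is closed.  Loops and multiple edges are allowed.
   Transitivity is connectedness, and forces at least one dart; the only
   decomposition without edges (one vertex and one 2-cell on the sphere) has a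
   2-cell with m = 0 boundary edges, and 0 = (0 - 2) pi is false. *)
Record cell_decomposition := CellDecomposition {
  dart : finType;
  flip : {perm dart};
  turn : {perm dart};
  flip_involutive : involutive flip;
  flip_neq : forall d, flip d != d;
  flip_turn_transitive :
    [transitive <<[set flip; turn]>>%g, on [set: dart] | 'P]%act
}.

Section Cells.
Variable D : cell_decomposition.

(* After [d], the boundary of the 2-cell on a fixed side of [d] continues with
   the dart following [flip d] around the end point of [d]. *)
Definition face_next : {perm dart D} := (flip D * turn D)%g.

Definition vertex : finType := {v : {set dart D} | v \in porbits (turn D)}.
Definition edge : finType := {e : {set dart D} | e \in porbits (flip D)}.
Definition face : finType := {f : {set dart D} | f \in porbits face_next}.

Definition origin (d : dart D) : vertex :=
  exist _ (porbit (turn D) d) (imset_f _ (isT : d \in predT)).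
Definition target (d : dart D) : vertex := origin (flip D d).
Definition edge_of (d : dart D) : edge :=
  exist _ (porbit (flip D) d) (imset_f _ (isT : d \in predT)).

Definition euler_char : int :=
  #|vertex|%:Z - #|edge|%:Z + #|face|%:Z.

End Cells.

Section Curvature.
Variable R : realType.

(* Distance of the centers of two circles of radii [ri], [rj] with exterior
   intersection angle [phi]. *)
Definition center_dist (ri rj phi : R) : R :=
  Num.sqrt (ri ^+ 2 + rj ^+ 2 + 2 * ri * rj * cos phi).

(* Inner angle between the sides of lengths [a] and [b] of a Euclidean triangle
   whose third side has length [c]. *)
Definition triangle_angle (a b c : R) : R :=
  acos ((a ^+ 2 + b ^+ 2 - c ^+ 2) / (2 * a * b)).

Definition theta (ri rj phi : R) : R :=
  triangle_angle ri (center_dist ri rj phi) rj.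

Variables (D : cell_decomposition) (Phi : edge D -> R).

Definition character (i : vertex D) : R :=
  \sum_(d in val i) Phi (edge_of d).

Definition curvature (r : vertex D -> R) (i : vertex D) : R :=
  2 * pi - 2 * \sum_(d in val i) theta (r i) (r (target d)) (Phi (edge_of d)).

End Curvature.

(* Main.v *)
Require Import Defs.
From mathcomp Require Import all_boot all_order all_algebra all_fingroup.
From mathcomp Require Import all_classical all_reals all_analysis.
From mathcomp Require Import ring lra.
Import Order.TTheory GRing.Theory Num.Theory.
Local Open Scope classical_set_scope.
Local Open Scope ring_scope.

(** Write [L_i] for the character at the vertex [i].  The numbers [2 pi - L_i]
    are governed by one fact: in the triangle spanned by two circles with
    exterior angle [phi], the angle at the intersection point is [pi - phi], so
    the two angles at the centers add up to [phi] ([theta_add]).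

    Summing the curvatures over the vertices is the same as summing angles over
    the darts, and pairing each dart with its reverse turns the angles into the
    weights; hence the total curvature is [\sum_i (2 pi - L_i)] for every choice
    of radii ([sum_curvature]).  The curvatures therefore cannot all lie
    strictly below the corresponding [2 pi - L_i], which is the second claim.

    On the other hand, the condition on the 2-cells gives
    [\sum_i (2 pi - L_i) = 2 pi chi(S)] ([sum_two_pi_sub_character]).  A point
    of this total sum all of whose coordinates are at least [2 pi - L_i] must be
    the point [2 pi - L] itself.  Equal radii attain it: both angles at the
    centers are then [phi / 2] ([curvature_const]). *)

(** * Orbits of a permutation *)

Section PermOrbits.
Variables (T : finType) (s : {perm T}).

Lemma mem_porbit_eq (o : {set T}) d :
  o \in porbits s -> (d \in o) = (porbit s d == o).
Proof.
by move=> /imsetP[x _ ->]; rewrite eq_sym eq_porbit_mem porbit_sym.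
Qed.

Lemma sum_porbits (V : nmodType) (F : T -> V) :
  \sum_(o : {o : {set T} | o \in porbits s}) \sum_(d in val o) F d =
  \sum_d F d.
Proof.
pose cls d : {o : {set T} | o \in porbits s} :=
  exist _ (porbit s d) (imset_f _ (isT : d \in predT)).
rewrite [RHS](partition_big cls predT) //=; apply: eq_bigr => o _.
by apply: eq_bigl => d; rewrite (mem_porbit_eq _ _ (valP o)) -val_eqE.
Qed.

End PermOrbits.

(** * The angles of a pair of circles *)

Section Angles.
Variable R : realType.
Implicit Types a b phi : R.

(** The squared distance is [(a - b)^2 + 2 a b (1 + cos phi)], and
    [cos phi > -1]: the two centers are distinct. *)
Lemma center_dist_sqr_gt0 a b phi : 0 < a -> 0 < b -> 0 < phi < pi ->
  0 < a ^+ 2 + b ^+ 2 + 2 * a * b * cos phi.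
Proof.
move=> a0 b0 /andP[phi0 phipi].
have cgt : -1 < cos phi.
  by rewrite -cospi ltr_cos // in_itv /= ?(ltW phi0) ?(ltW phipi) ?pi_ge0 /=.
have ab0 : 0 < a * b by rewrite mulr_gt0.
have h : 0 < (a * b) * (1 + cos phi) by rewrite mulr_gt0 //; lra.
have := sqr_ge0 (a - b); nra.
Qed.

Lemma sin_gt0_lt_pi (x : R) : 0 <= x <= 2 * pi -> 0 < sin x -> x < pi.
Proof.
move=> /andP[x0 x2] sx; rewrite ltNge; apply/negP => pix.
have : 0 <= sin (x - pi) by apply: sin_ge0_pi; apply/andP; split; lra.
by move: sx; rewrite -[x in sin x](subrK pi) sinDpi; lra.
Qed.

Lemma center_distC a b phi : center_dist b a phi = center_dist a b phi.
Proof. by rewrite /center_dist; congr Num.sqrt; ring. Qed.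

(** Project the triangle on the line through the center of radius [a] and the
    intersection point, and on its normal: the other center has coordinates
    [a + b cos phi] and [b sin phi] as seen from the first one. *)
Lemma cos_sin_theta a b phi (c := center_dist a b phi) :
    0 < a -> 0 < b -> 0 < phi < pi ->
  [/\ 0 <= theta a b phi <= pi, cos (theta a b phi) = (a + b * cos phi) / c
    & sin (theta a b phi) = b * sin phi / c].
Proof.
move=> a0 b0 phi_range.
have q0 := center_dist_sqr_gt0 a b phi a0 b0 phi_range.
have c0 : 0 < c by rewrite sqrtr_gt0.
have c2 : c ^+ 2 = a ^+ 2 + b ^+ 2 + 2 * a * b * cos phi.
  by rewrite sqr_sqrtr // ltW.
have sphi : 0 < sin phi by apply: sin_gt0_pi.
set u := (a + b * cos phi) / c; set v := b * sin phi / c.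
have v0 : 0 <= v by rewrite divr_ge0 ?mulr_ge0 // ltW.
have uv1 : u ^+ 2 + v ^+ 2 = 1.
  rewrite /u /v !expr_div_n -mulrDl; apply/(canLR (mulfK _)).
    by rewrite expf_neq0 ?gt_eqF.
  by rewrite mul1r c2; have := cos2Dsin2 phi; nra.
have u1 : -1 <= u <= 1.
  by have := sqr_ge0 v => v2; apply/andP; split; nra.
have thetaE : theta a b phi = acos u.
  rewrite /theta /triangle_angle -/c; congr acos; rewrite c2 /u; field.
  by rewrite !gt_eqF.
rewrite thetaE; split.
- by rewrite acos_ge0 ?acos_lepi.
- by rewrite acosK.
- rewrite sin_acos //; have -> : 1 - u ^+ 2 = v ^+ 2 by lra.
  by rewrite sqrtr_sqr ger0_norm.
Qed.

(** The third angle of the triangle is [pi - phi].  Both angles being in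
    [[0, pi]], their sum is determined by its cosine and the sign of its sine,
    which the addition formulas show to be those of [phi]. *)
Lemma theta_add a b phi : 0 < a -> 0 < b -> 0 < phi < pi ->
  theta a b phi + theta b a phi = phi.
Proof.
move=> a0 b0 phi_range.
have [/andP[t0 tpi] ct st] := cos_sin_theta a b phi a0 b0 phi_range.
have [/andP[t0' tpi'] ct' st'] := cos_sin_theta b a phi b0 a0 phi_range.
have q0 := center_dist_sqr_gt0 a b phi a0 b0 phi_range.
have c0 : 0 < center_dist a b phi by rewrite sqrtr_gt0.
have c2 : center_dist a b phi ^+ 2 = a ^+ 2 + b ^+ 2 + 2 * a * b * cos phi.
  by rewrite sqr_sqrtr // ltW.
rewrite center_distC in ct' st'.
move: c0 c2 ct st ct' st'; set c := center_dist a b phi => c0 c2 ct st ct' st'.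
have c_neq0 : c != 0 by rewrite gt_eqF.
have cs := cos2Dsin2 phi.
have cosE : cos (theta a b phi + theta b a phi) = cos phi.
  rewrite cosD ct st ct' st'.
  apply: (mulIf (expf_neq0 2 c_neq0)); rewrite [in RHS]c2.
  have -> : ((a + b * cos phi) / c * ((b + a * cos phi) / c) -
      b * sin phi / c * (a * sin phi / c)) * c ^+ 2 =
      (a + b * cos phi) * (b + a * cos phi) - a * b * sin phi ^+ 2 by field.
  by rewrite (_ : sin phi ^+ 2 = 1 - cos phi ^+ 2); [ring | lra].
have sinE : sin (theta a b phi + theta b a phi) = sin phi.
  rewrite sinD ct st ct' st'.
  apply: (mulIf (expf_neq0 2 c_neq0)); rewrite [in RHS]c2.
  by field.
case/andP: (phi_range) => phi0 phipi.
have sum_lt : theta a b phi + theta b a phi < pi.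
  apply: sin_gt0_lt_pi; last by rewrite sinE sin_gt0_pi.
  by apply/andP; split; lra.
by apply: cos_inj cosE; rewrite in_itv /=; apply/andP; split; lra.
Qed.

End Angles.

(** * Total curvature *)

Section TotalCurvature.
Variables (R : realType) (D : cell_decomposition) (Phi : edge D -> R).
Hypothesis Phi_range : forall e : edge D, 0 < Phi e < pi.

Lemma mem_vertex (i : vertex D) (d : dart D) : d \in val i -> origin d = i.
Proof.
move=> di; apply: val_inj; apply/eqP.
by rewrite -mem_porbit_eq // (valP i).
Qed.

Lemma edge_of_flip (d : dart D) : edge_of (flip D d) = edge_of d.
Proof.
by apply: val_inj; apply/eqP; rewrite /= eq_porbit_mem (mem_porbit _ 1).
Qed.

Lemma target_flip (d : dart D) : target (flip D d) = origin d.
Proof. by rewrite /target flip_involutive. Qed.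

Lemma card_edge_darts (e : edge D) : #|val e| = 2.
Proof.
case: e => e /= /imsetP[d _ ->].
have -> : porbit (flip D) d = [set d; flip D d]%SET.
  apply/setP => x; rewrite !inE; apply/porbitP/orP => [[n ->]|].
    elim: n => [|n IHn]; first by rewrite expg0 perm1 eqxx; left.
    rewrite expgSr permM.
    by case: IHn => /eqP ->; rewrite ?flip_involutive eqxx; [right|left].
  by case=> /eqP ->; [exists 0; rewrite expg0 perm1 | exists 1; rewrite expg1].
by rewrite cards2 eq_sym flip_neq.
Qed.

Lemma card_darts : #|dart D| = (2 * #|edge D|)%N.
Proof.
rewrite -[LHS]sum1_card -(sum_porbits _ (flip D)).
under eq_bigr => e _ do rewrite sum1_card card_edge_darts.
by rewrite sum_nat_const mulnC.
Qed.

Lemma sum_character :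
  \sum_i character Phi i = \sum_d Phi (edge_of d).
Proof. exact: sum_porbits. Qed.

(** Every dart [d] contributes the angle at its origin and [flip d] the angle
    at its other end; together these are the weight of the edge. *)
Lemma sum_theta (r : vertex D -> R) : (forall i, 0 < r i) ->
  2 * \sum_d theta (r (origin d)) (r (target d)) (Phi (edge_of d)) =
  \sum_d Phi (edge_of d).
Proof.
move=> r0; rewrite mulrDl mul1r.
rewrite [X in _ + X](reindex_inj (@perm_inj _ (flip D))) -big_split /=.
apply: eq_bigr => d _.
by rewrite edge_of_flip target_flip theta_add.
Qed.

Lemma sum_curvature (r : vertex D -> R) : (forall i, 0 < r i) ->
  \sum_i curvature Phi r i = \sum_i (2 * pi - character Phi i).
Proof.
move=> r0; rewrite !sumrB; congr (_ - _).
rewrite -mulr_sumr sum_character -(sum_theta r r0) -(sum_porbits _ (turn D)).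
congr (_ * _).
by apply: eq_bigr => i _; apply: eq_bigr => d /mem_vertex ->.
Qed.

Lemma curvature_const (i : vertex D) :
  curvature Phi (fun=> 1) i = 2 * pi - character Phi i.
Proof.
rewrite /curvature mulr_sumr; congr (_ - _); apply: eq_bigr => d _.
by rewrite mulrDl mul1r theta_add.
Qed.

(** Counting darts by 2-cells, the weights sum to [(2 |E| - 2 |F|) pi]: this is
    the Gauss-Bonnet formula for the point [2 pi - L]. *)
Lemma sum_two_pi_sub_character
    (Phi_face : forall f : face D,
       \sum_(d in val f) Phi (edge_of d) = (#|val f|%:R - 2) * pi) :
  \sum_i (2 * pi - character Phi i) = 2 * pi * (euler_char D)%:~R.
Proof.
rewrite sumrB sum_character sumr_const -(sum_porbits _ (face_next D)).
rewrite (eq_bigr _ (fun f _ => Phi_face f)) -mulr_suml sumrB sumr_const.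
have -> : \sum_(f : face D) #|val f|%:R = (2 * #|edge D|)%:R :> R.
  rewrite -card_darts -natr_sum; congr (_%:R).
  rewrite -[RHS]sum1_card -(sum_porbits _ (face_next D)).
  by apply: eq_bigr => f _; rewrite sum1_card.
rewrite /euler_char intrD intrB -!pmulrn natrM.
by rewrite -[2 * pi *+ _]mulr_natr -[2 *+ _]mulr_natr; ring.
Qed.

End TotalCurvature.

Theorem theorem1p14 (R : realType) (D : cell_decomposition)
    (Phi : edge D -> R)
    (Phi_range : forall e : edge D, 0 < Phi e < pi)
    (Phi_face : forall f : face D,
       \sum_(d in val f) Phi (edge_of d) = (#|val f|%:R - 2) * pi) :
  let K_image : set (vertex D -> R) :=
    curvature Phi @` [set r : vertex D -> R | forall i, 0 < r i] in
  [set x : vertex D -> R | \sum_(i : vertex D) x i = 2 * pi * (euler_char D)%:~R]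
    `&` [set x : vertex D -> R |
          forall i, x i \in `[2 * pi - character Phi i, 2 * pi[%R]
    `<=` K_image
  /\
  [set x : vertex D -> R | forall i, x i \in `]-oo, 2 * pi - character Phi i[%R]
    `&` K_image = set0.
Proof.
move=> K_image; split.
  move=> x [/= sum_x x_range]; exists (fun=> 1) => //=.
  (* The coordinates dominate those of a point with the same total sum. *)
  have ge_x i : 2 * pi - character Phi i <= x i.
    by have := x_range i; rewrite in_itv /= => /andP[].
  have sum0 : \sum_i (x i - (2 * pi - character Phi i)) = 0.
    by rewrite sumrB sum_x sum_two_pi_sub_character // subrr.
  apply/funext => i; rewrite curvature_const //; apply/esym/eqP.
  rewrite -subr_eq0; apply/eqP; apply: (psumr_eq0P _ sum0) => // j _.
  by rewrite subr_ge0.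
rewrite -subset0 => x [/= x_range [r /= r0 Krx]].
have lt_K i : curvature Phi r i < 2 * pi - character Phi i.
  by have := x_range i; rewrite in_itv /= Krx.
have [d _ _] := imsetP (flip_turn_transitive D).
suff : \sum_i curvature Phi r i < \sum_i (2 * pi - character Phi i).
  by rewrite sum_curvature // ltxx.
apply: ltr_sum => //; apply/hasP.
by exists (origin d); rewrite // mem_index_enum.
Qed.
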